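(* The semigroup $\mathbf{ID}_{\infty}$ is isomorphic to the semidirect product $\mathrm{Iso}(\mathbb{Z})\ltimes_{\mathfrak{h}}\mathscr{P}_{\!\infty}(\mathbb{Z})$ of the free semilattice with unit $(\mathscr{P}_{\!\infty}(\mathbb{Z}),\cup)$ by the group $\mathrm{Iso}(\mathbb{Z})$ of all isometries of the set of integers $\mathbb{Z}$.
   Context: A partial cofinite isometry of the set of integers $\mathbb{Z}$ is a partial map $\alpha\colon\mathbb{Z}\rightharpoonup\mathbb{Z}$ such that $\mathbb{Z}\setminus\operatorname{dom}\alpha$ and $\mathbb{Z}\setminus\operatorname{ran}\alpha$ are finite and $|(x)\alpha-(y)\alpha|=|x-y|$ for all $x,y\in\operatorname{dom}\alpha$. $\mathbf{ID}_{\infty}$ is the semigroup (an inverse monoid) of all partial cofinite isometries of $\mathbb{Z}$ under composition of partial maps; maps are written on the right, so $(x)(\alpha\beta)=((x)\alpha)\beta$, and products in $\mathrm{Iso}(\mathbb{Z})$ are likewise composed left to right. $(\mathscr{P}_{\!\infty}(\mathbb{Z}),\cup)$ is the set of all finite subsets of $\mathbb{Z}$ (including the empty set) with the operation of union. For semigroups $A,B$ and a homomorphism $\mathfrak{h}\colon A\to\mathrm{End}(B)$, $a\mapsto\mathfrak{h}_a$ (endomorphisms written on the right and composed left to right), the semidirect product $A\ltimes_{\mathfrak{h}}B$ is the set $A\times B$ with the operation $(a_1,b_1)\cdot(a_2,b_2)=(a_1a_2,(b_1)\mathfrak{h}_{a_2}\,b_2)$. Here $\mathfrak{h}$ is the conjugation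 action $(\varepsilon)\mathfrak{h}_\gamma=\gamma^{-1}\varepsilon\gamma$ of the group of units $\mathrm{Iso}(\mathbb{Z})$ on the semilattice of idempotents of $\mathbf{ID}_{\infty}$, where an idempotent $\varepsilon$ (a partial identity map) is identified with the finite set $\mathbb{Z}\setminus\operatorname{dom}\varepsilon\in\mathscr{P}_{\!\infty}(\mathbb{Z})$; equivalently $(F)\mathfrak{h}_\gamma=\{(x)\gamma\colon x\in F\}$ for $\gamma\in\mathrm{Iso}(\mathbb{Z})$ and $F\in\mathscr{P}_{\!\infty}(\mathbb{Z})$. *)

(* Defs.v *)
From HB Require Import structures.
From mathcomp Require Import all_boot all_order all_algebra finmap.
From mathcomp Require Import boolp classical_sets cardinality.

Set Implicit Arguments.
Unset Strict Implicit.
Unset Printing Implicit Defensive.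

Import Order.TTheory GRing.Theory Num.Theory.

Local Open Scope classical_set_scope.
Local Open Scope ring_scope.

(* Endomorphisms act on the right: the product [f * g] is "f, then g". *)
Definition endo (B : semigroupType) : Type := {multiplicative B -> B}.

Section Endo.
Variable B : semigroupType.

HB.instance Definition _ := gen_eqMixin (endo B).
HB.instance Definition _ := gen_choiceMixin (endo B).

Lemma endoP (f g : endo B) : f =1 g -> f = g.
Proof.
case: f g => [f [[fM]]] [g [[gM]]] /= /funext fg.
by subst g; rewrite (Prop_irrelevance fM gM).
Qed.

Definition endo_mul (f g : endo B) : endo B := g \o f.

Lemma endo_mulA : associative endo_mul.
Proof. by move=> f g h; apply: endoP. Qed.

HB.instance Definition _ := isSemigroup.Build (endo B) endo_mulA.

End Endo.

Definition sdprod (A B : semigroupType) (h : {multiplicative A -> endo B}) :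
  Type := (A * B)%type.

Section SemidirectProduct.
Variables (A B : semigroupType) (h : {multiplicative A -> endo B}).

HB.instance Definition _ := Choice.copy (sdprod h) (A * B)%type.

Definition sdprod_mul (u v : sdprod h) : sdprod h :=
  ((u.1 * v.1)%g, (h v.1 u.2 * v.2)%g).

Lemma sdprod_mulA : associative sdprod_mul.
Proof.
move=> [a1 b1] [a2 b2] [a3 b3]; rewrite /sdprod_mul /=.
by rewrite (@gmulfM _ _ (h a3)) (@gmulfM _ _ h) !mulgA.
Qed.

HB.instance Definition _ := isSemigroup.Build (sdprod h) sdprod_mulA.

End SemidirectProduct.

Definition pdom (f : int -> option int) : set int := [set x | isSome (f x)].
Definition pran (f : int -> option int) : set int :=
  [set y | exists x, f x = Some y].

Record IDinf : Type := MkIDinf {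
  pfun :> int -> option int;
  pfun_dom : finite_set (~` pdom pfun);
  pfun_ran : finite_set (~` pran pfun);
  pfun_isom : forall x y x' y' : int,
    pfun x = Some x' -> pfun y = Some y' -> `|x' - y'| = `|x - y| }.

HB.instance Definition _ := gen_eqMixin IDinf.
HB.instance Definition _ := gen_choiceMixin IDinf.

Lemma IDinfP (f g : IDinf) : pfun f =1 pfun g -> f = g.
Proof.
case: f g => [f f1 f2 f3] [g g1 g2 g3] /= /funext fg; subst g.
by rewrite (Prop_irrelevance f1 g1) (Prop_irrelevance f2 g2)
           (Prop_irrelevance f3 g3).
Qed.

Lemma pfun_inj (f : IDinf) (x y z : int) :
  f x = Some z -> f y = Some z -> x = y.
Proof.
move=> fx fy; have := pfun_isom fx fy.
by rewrite subrr normr0 => /esym/eqP; rewrite normr_eq0 subr_eq0 => /eqP.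
Qed.

Section Composition.
Variables f g : IDinf.

Let fg : int -> option int := pcomp g f.

Lemma comp_dom : finite_set (~` pdom fg).
Proof.
have [h hP] : exists h : int -> int, forall x y, f x = Some y -> h y = x.
  exists (fun y => xget 0 [set x | f x = Some y]) => x y fx.
  by case: xgetP => [z _ /= fz|/(_ x)/(_ fx)//]; apply: pfun_inj fz fx.
apply: (@sub_finite_set _ _ (~` pdom f `|` h @` (~` pdom g))).
  move=> x /=; rewrite /pdom /fg /pcomp /=.
  by case fx: (f x) => [y|] /= gy; [right; exists y => //; apply: hP|left].
by rewrite finite_setU; split; [apply: pfun_dom|
  apply: finite_image; apply: pfun_dom].
Qed.

Lemma comp_ran : finite_set (~` pran fg).
Proof.
apply: (@sub_finite_set _ _ (~` pran g `|` (odflt 0 \o g) @` (~` pran f))).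
  move=> z /= nz; have [[y gy]|ng] := pselect (pran g z); last by left.
  right; exists y; last by rewrite /= gy.
  by move=> [x fx]; apply: nz; exists x; rewrite /fg /pcomp fx.
by rewrite finite_setU; split; [apply: pfun_ran|
  apply: finite_image; apply: pfun_ran].
Qed.

Lemma comp_isom (x y x' y' : int) :
  fg x = Some x' -> fg y = Some y' -> `|x' - y'| = `|x - y|.
Proof.
rewrite /fg /pcomp; case fx: (f x) => [u|] //= gu.
case fy: (f y) => [v|] //= gv.
by rewrite (pfun_isom gu gv) (pfun_isom fx fy).
Qed.

(* [pcomp g f] applies [f] first. *)
Definition IDinf_mul : IDinf := MkIDinf comp_dom comp_ran comp_isom.

End Composition.

Lemma IDinf_mulA : associative IDinf_mul.
Proof. by move=> f g h; apply: IDinfP => x /=; rewrite /pcomp; case: (f x). Qed.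

HB.instance Definition _ := isSemigroup.Build IDinf IDinf_mulA.

Record IsoZ : Type := MkIsoZ {
  iso_fun :> int -> int;
  iso_bij : bijective iso_fun;
  iso_isom : forall x y : int, `|iso_fun x - iso_fun y| = `|x - y| }.

HB.instance Definition _ := gen_eqMixin IsoZ.
HB.instance Definition _ := gen_choiceMixin IsoZ.

Lemma IsoZP (f g : IsoZ) : iso_fun f =1 iso_fun g -> f = g.
Proof.
case: f g => [f f1 f2] [g g1 g2] /= /funext fg; subst g.
by rewrite (Prop_irrelevance f1 g1) (Prop_irrelevance f2 g2).
Qed.

(* Products are composed left to right: [f * g] is "f, then g". *)
Definition IsoZ_mul (f g : IsoZ) : IsoZ :=
  @MkIsoZ (g \o f) (bij_comp (iso_bij g) (iso_bij f))
    (fun x y => etrans (iso_isom g (f x) (f y)) (iso_isom f x y)).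

Definition IsoZ_one : IsoZ :=
  @MkIsoZ id (@Bijective _ _ id id (frefl _) (frefl _)) (fun _ _ => erefl).

Lemma IsoZ_ex_inv (f : IsoZ) : exists g : IsoZ, cancel f g /\ cancel g f.
Proof.
have [g fK gK] := iso_bij f.
have gI x y : `|g x - g y| = `|x - y| by rewrite -[LHS](iso_isom f) !gK.
by exists (@MkIsoZ g (Bijective gK fK) gI).
Qed.

Definition IsoZ_inv (f : IsoZ) : IsoZ := sval (cid (IsoZ_ex_inv f)).

Lemma IsoZ_invK (f : IsoZ) : cancel f (IsoZ_inv f).
Proof. by rewrite /IsoZ_inv; case: cid => g []. Qed.

Lemma IsoZ_Kinv (f : IsoZ) : cancel (IsoZ_inv f) f.
Proof. by rewrite /IsoZ_inv; case: cid => g []. Qed.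

Lemma IsoZ_mulA : associative IsoZ_mul.
Proof. by move=> f g h; apply: IsoZP. Qed.
Lemma IsoZ_mul1 : left_id IsoZ_one IsoZ_mul.
Proof. by move=> f; apply: IsoZP. Qed.
Lemma IsoZ_mulr1 : right_id IsoZ_one IsoZ_mul.
Proof. by move=> f; apply: IsoZP. Qed.
Lemma IsoZ_mulV : left_inverse IsoZ_one IsoZ_inv IsoZ_mul.
Proof. by move=> f; apply: IsoZP => x; apply: IsoZ_Kinv. Qed.
Lemma IsoZ_mulrV : right_inverse IsoZ_one IsoZ_inv IsoZ_mul.
Proof. by move=> f; apply: IsoZP => x; apply: IsoZ_invK. Qed.

HB.instance Definition _ :=
  isGroup.Build IsoZ IsoZ_mulA IsoZ_mul1 IsoZ_mulr1 IsoZ_mulV IsoZ_mulrV.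

Definition PinfZ : Type := {fset int}.

HB.instance Definition _ := Choice.copy PinfZ {fset int}.

Definition PinfZ_mul (F G : PinfZ) : PinfZ := (F `|` G)%fset.

Lemma PinfZ_mulA : associative PinfZ_mul.
Proof. by move=> F G H; apply: fsetUA. Qed.
Lemma PinfZ_mul1 : left_id (fset0 : PinfZ) PinfZ_mul.
Proof. by move=> F; apply: fset0U. Qed.
Lemma PinfZ_mulr1 : right_id (fset0 : PinfZ) PinfZ_mul.
Proof. by move=> F; apply: fsetU0. Qed.

HB.instance Definition _ :=
  isMonoid.Build PinfZ PinfZ_mulA PinfZ_mul1 PinfZ_mulr1.

Lemma PinfZ_mulC : commutative ( *%g : PinfZ -> PinfZ -> PinfZ).
Proof. by move=> F G; apply: fsetUC. Qed.

Lemma PinfZ_mulxx : idempotent_op ( *%g : PinfZ -> PinfZ -> PinfZ).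
Proof. by move=> F; apply: fsetUid. Qed.

(* [PinfZ] is the free semilattice with unit on [int]. *)
Lemma PinfZ_free (S : monoidType) (f : int -> S) :
    commutative ( *%g : S -> S -> S) -> idempotent_op ( *%g : S -> S -> S) ->
  exists! g : PinfZ -> S,
    [/\ g 1%g = 1%g, {morph g : F G / (F * G)%g}
      & forall x : int, g [fset x]%fset = f x].
Proof.
move=> mulC mulxx.
pose op : Monoid.com_law (1%g : S) :=
  HB.pack ( *%g : S -> S -> S)
    (Monoid.isComLaw.Build S 1%g *%g (@mulgA S) mulC (@mul1g S)).
pose g (F : PinfZ) : S := \big[op/1%g]_(x <- (F : {fset int})) f x.
exists g; split.
  split; first exact: big_seq_fset0.
    move=> F G; rewrite /g -[RHS]/(op _ _) -big_cat.
    by apply: eq_big_idem => // x; rewrite mem_cat; apply: in_fsetU.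
  by move=> x; rewrite /g big_seq_fset1.
move=> g' [g'1 g'M g'f]; apply: funext => F; rewrite /g.
have g's (s : seq int) : g' [fset x in s]%fset = \big[op/1%g]_(x <- s) f x.
  elim: s => [|x s IHs]; first by rewrite big_nil -g'1 fset_nil.
  by rewrite big_cons -IHs fset_cons [LHS]g'M g'f.
by rewrite -g's; congr g'; apply/fsetP => x; rewrite !inE.
Qed.

Definition img (c : IsoZ) (F : PinfZ) : PinfZ := [fset c x | x in F]%fset.

Lemma img_mul (c : IsoZ) (F G : PinfZ) : img c (F * G)%g = (img c F * img c G)%g.
Proof. exact: imfsetU. Qed.

HB.instance Definition _ (c : IsoZ) :=
  isMultiplicative.Build PinfZ PinfZ (img c) (img_mul c).

Definition conj_act (c : IsoZ) : endo PinfZ := img c : {multiplicative _ -> _}.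

Lemma conj_act_mul (c d : IsoZ) :
  conj_act (c * d)%g = (conj_act c * conj_act d)%g.
Proof.
apply: endoP => F; apply/fsetP => y; apply/imfsetP/imfsetP => /=.
  by move=> [x xF ->]; exists (c x); rewrite ?in_imfset.
by move=> [z /imfsetP[x /= xF ->] ->]; exists x.
Qed.

HB.instance Definition _ :=
  isMultiplicative.Build IsoZ (endo PinfZ) conj_act conj_act_mul.

(* [conj_act] is conjugation by units of [IDinf], once a finite set [F] is
   identified with the idempotent whose domain is the complement of [F]. *)
Section Conjugation.

Lemma unit_dom (c : IsoZ) : finite_set (~` pdom (Some \o c)).
Proof.
by rewrite (_ : ~` _ = set0) // -subset0 => x /=; rewrite /pdom /=; apply.
Qed.

Lemma unit_ran (c : IsoZ) : finite_set (~` pran (Some \o c)).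
Proof.
rewrite (_ : ~` _ = set0) // -subset0 => y /=; apply.
by exists (c^-1%g y); rewrite /= IsoZ_Kinv.
Qed.

Lemma unit_isom (c : IsoZ) (x y x' y' : int) :
  (Some \o c) x = Some x' -> (Some \o c) y = Some y' -> `|x' - y'| = `|x - y|.
Proof. by move=> [<-] [<-]; apply: iso_isom. Qed.

Definition unit_of (c : IsoZ) : IDinf :=
  MkIDinf (unit_dom c) (unit_ran c) (@unit_isom c).

Definition pid (F : PinfZ) (x : int) : option int :=
  if x \in (F : {fset int}) then None else Some x.

Lemma pid_dom F : ~` pdom (pid F) = [set` (F : {fset int})].
Proof.
apply/seteqP; split=> x; rewrite /pdom /pid /=; by case: ifP => // _; case.
Qed.

Lemma pid_ran F : pran (pid F) = pdom (pid F).
Proof.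
apply/seteqP; split=> x; rewrite /pdom /pran /=.
  by move=> [y]; rewrite /pid; case: ifP => // yF [<-]; rewrite yF.
by rewrite /pid; case: ifP => // xF _; exists x; rewrite xF.
Qed.

Lemma pid_isom F (x y x' y' : int) :
  pid F x = Some x' -> pid F y = Some y' -> `|x' - y'| = `|x - y|.
Proof. by rewrite /pid; case: ifP => // _ [<-]; case: ifP => // _ [<-]. Qed.

Definition idem_of (F : PinfZ) : IDinf.
Proof.
by apply: (@MkIDinf (pid F) _ _ (@pid_isom F)); rewrite ?pid_ran pid_dom;
  apply: finite_fset.
Defined.

Lemma idem_ofP (e : IDinf) : (e * e = e)%g <-> exists F, e = idem_of F.
Proof.
split=> [ee|[F ->]]; last first.
  by apply: IDinfP => x; rewrite /= /pcomp /= /pid; case: ifP => //= ->.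
have eid x y : e x = Some y -> y = x.
  move=> ex; have := congr1 (fun f : IDinf => f x) ee.
  by rewrite /= /pcomp ex /= => ey; apply: pfun_inj ey ex.
exists (fset_set (~` pdom e)); apply: IDinfP => x /=; rewrite /pid.
rewrite in_fset_set; last exact: pfun_dom.
case ex: (e x) => [y|].
  by rewrite memNset ?(eid _ _ ex) //= /pdom /= ex; apply.
by rewrite mem_set //= /pdom /= ex.
Qed.

Lemma conj_actE (c : IsoZ) (F : PinfZ) :
  idem_of (conj_act c F) = (unit_of c^-1 * idem_of F * unit_of c)%g.
Proof.
apply: IDinfP => x; rewrite /= /pcomp /= /pid.
rewrite -[x in x \in _](IsoZ_Kinv c) mem_imfset; last exact/bij_inj/iso_bij.
by case: ifP => //= _; rewrite IsoZ_Kinv.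
Qed.

End Conjugation.

(* Main.v *)
Require Import Defs.
From mathcomp Require Import all_boot.
From HB Require Import structures.
From mathcomp Require Import all_order all_algebra finmap zify.
From mathcomp Require Import boolp classical_sets functions cardinality.

(** Every partial cofinite isometry is a total isometry followed by the
partial identity that deletes the integers outside its range, and this
factorization is unique.  Both facts rest on the rigidity of the line: an
integer is determined by its distances to two distinct integers
([eq_of_dist]).  A cofinite domain contains two distinct points
([cofinite_pair]); the affine map [x |-> f(a) + s (x - a)] with [s = 1] or
[s = -1] that agrees with the partial isometry at these two points must then
agree with it on its whole domain ([extend_isometry]), and two total isometries that
agree at two distinct points are equal ([IsoZ_eq]).  Hence
[(c, F) |-> unit_of c * idem_of F] is a bijection from the semidirect product
onto [IDinf].  It is a homomorphism because moving an idempotent across a unit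
conjugates it, [e d = d (d^-1 e d)], which is how the semidirect product
multiplies.  The isomorphism is the inverse of this bijection. *)

Set Implicit Arguments.
Unset Strict Implicit.
Unset Printing Implicit Defensive.

Local Open Scope classical_set_scope.
Local Open Scope ring_scope.

(** If [y] and [y'] were distinct, equidistance would force both [p] and [q]
to be their midpoint. *)
Lemma eq_of_dist (p q y y' : int) :
  p <> q -> `|y - p| = `|y' - p| -> `|y - q| = `|y' - q| -> y = y'.
Proof. lia. Qed.

Lemma cofinite_point (A : set int) : finite_set A -> exists x, ~ A x.
Proof.
move=> Afin; apply: contrapT => /forallNP noA; apply: infinite_nat.
rewrite (_ : [set: nat] = Posz @^-1` A).
  by apply: finite_preimage Afin => m n _ _ [].
by apply/seteqP; split=> // n _; apply: contrapT; apply: noA.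
Qed.

Lemma cofinite_pair (A : set int) :
  finite_set A -> exists a b, [/\ ~ A a, ~ A b & a <> b].
Proof.
move=> Afin; have [a Aa] := cofinite_point Afin.
have [|b Ab] := @cofinite_point (A `|` [set a]).
  by rewrite finite_setU; split=> //; apply: finite_set1.
by exists a, b; split=> // [Ab'|ab]; apply: Ab; [left|right].
Qed.

Lemma pdom_pair (f : IDinf) :
  exists a b fa fb, [/\ f a = Some fa, f b = Some fb & a <> b].
Proof.
have [a [b [/contrapT + /contrapT + ab]]] := cofinite_pair (pfun_dom f).
rewrite /pdom /=; case fa: (f a) => [a'|//] _; case fb: (f b) => [b'|//] _.
by exists a, b, a', b'.
Qed.

Lemma IsoZ_eq (c d : IsoZ) (a b : int) :
  a <> b -> c a = d a -> c b = d b -> c = d.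
Proof.
move=> ab ca cb; apply: IsoZP => x.
have cab : c a <> c b by move/(bij_inj (iso_bij c)).
apply: (eq_of_dist cab); first by rewrite [in RHS]ca !iso_isom.
by rewrite [in RHS]cb !iso_isom.
Qed.

(** The sign [s] records whether [a |-> a'], [b |-> b'] preserves or reverses
the order. *)
Lemma affine_isometry (a b a' b' : int) :
  `|a' - b'| = `|a - b| -> exists c : IsoZ, c a = a' /\ c b = b'.
Proof.
move=> dab; pose s : int := if b' - a' == b - a then 1 else -1.
pose c x := a' + s * (x - a); pose c' y := a + s * (y - a').
have cK : cancel c c' by move=> x; rewrite /c /c' /s; case: ifP => _; lia.
have c'K : cancel c' c by move=> x; rewrite /c /c' /s; case: ifP => _; lia.
have cI x y : `|c x - c y| = `|x - y|.
  by rewrite /c /s; case: ifP => _; lia.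
exists (MkIsoZ (Bijective cK c'K) cI); rewrite /= /c /s.
by split; case: eqP; lia.
Qed.

Lemma extend_isometry (f : IDinf) :
  exists c : IsoZ, forall x y, f x = Some y -> c x = y.
Proof.
have [a [b [a' [b' [fa fb ab]]]]] := pdom_pair f.
have [c [ca cb]] := affine_isometry (pfun_isom fa fb).
exists c => x y fx.
have cab : c a <> c b by move/(bij_inj (iso_bij c)).
apply: (eq_of_dist cab); rewrite iso_isom.
  by rewrite ca (pfun_isom fx fa).
by rewrite cb (pfun_isom fx fb).
Qed.

Definition unit_idem (u : sdprod conj_act) : IDinf :=
  (unit_of u.1 * idem_of u.2)%g.

Lemma unit_idemE u x :
  unit_idem u x = if u.1 x \in (u.2 : {fset int}) then None else Some (u.1 x).
Proof. by []. Qed.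

(** An integer dies in the product when [c x] is in [F] or [d (c x)] is in [G];
as [d] is injective, this says that [d (c x)] is in the union of the image of
[F] under [d] with [G]. *)
Lemma unit_idemM : {morph unit_idem : u v / (u * v)%g}.
Proof.
move=> [c F] [d G]; apply: IDinfP => x.
rewrite /= /pcomp /= /pid /= in_fsetU /=.
rewrite mem_imfset; last exact/bij_inj/iso_bij.
(* [mem_imfset] leaves membership in [F] under another predicate structure. *)
rewrite [X in X || _](_ : _ = (c x \in (F : {fset int}))) //.
by case: (c x \in _).
Qed.

Lemma unit_idem_inj : injective unit_idem.
Proof.
move=> [c F] [d G] cFdG.
have eqx x : unit_idem (c, F) x = unit_idem (d, G) x by rewrite cFdG.
have [a [b [a' [b' [ea eb ab]]]]] := pdom_pair (unit_idem (c, F)).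
have cd : c = d.
  apply: (IsoZ_eq ab).
    by move: (eqx a) ea; rewrite !unit_idemE /=;
      do 2?case: ifP => // _; move=> [].
  by move: (eqx b) eb; rewrite !unit_idemE /=;
      do 2?case: ifP => // _; move=> [].
(* [y] is deleted exactly when the common map is undefined at [c^-1 y]. *)
subst d; congr (_, _); apply/fsetP => y.
move: (eqx (c^-1%g y)); rewrite !unit_idemE /= IsoZ_Kinv.
by do 2?case: ifP.
Qed.

(** The deleted set is the complement of the range, since the partial identity
is applied after the total isometry. *)
Lemma unit_idem_surj (f : IDinf) : exists u, unit_idem u = f.
Proof.
have [c cf] := extend_isometry f.
exists (c, fset_set (~` pran f)); apply: IDinfP => x.
rewrite unit_idemE /= in_fset_set; last exact: pfun_ran.
case fx: (f x) => [y|].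
  by rewrite (cf _ _ fx) memNset //=; apply; exists x.
rewrite mem_set //= => -[z fz].
by have /(bij_inj (iso_bij c)) zx := cf _ _ fz; rewrite zx fx in fz.
Qed.

Lemma unit_idem_bij : bijective unit_idem.
Proof.
rewrite -setTT_bijective; split=> //.
  by move=> u v _ _; apply: unit_idem_inj.
by move=> f _; have [u uf] := unit_idem_surj f; exists u.
Qed.

Theorem mainTheorem3 :
  exists f : {multiplicative IDinf -> sdprod conj_act}, bijective f.
Proof.
have [g unit_idemK gK] := unit_idem_bij.
have gM : {morph g : e f / (e * f)%g}.
  by move=> e f; apply: unit_idem_inj; rewrite unit_idemM !gK.
pose gm : {multiplicative IDinf -> sdprod conj_act} :=
  HB.pack g (isMultiplicative.Build _ _ g gM).
by exists gm; exists unit_idem.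
Qed.
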